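(* The functions $Q(x)$ and $1-Q(x)$ are log-concave, i.e. $\log Q(x)$ and $\log[1-Q(x)]$ are concave functions of $x\in\mathbb{R}$.
   Context: $Q(x)=\frac{1}{\sqrt{2\pi}}\int_x^\infty e^{-t^2/2}\,dt$. *)

(* Defs.v *)
From HB Require Import structures.
From mathcomp Require Import all_boot all_order all_algebra.
From mathcomp Require Import all_classical all_reals all_analysis.

Set Implicit Arguments.
Unset Strict Implicit.
Unset Printing Implicit Defensive.

Import Order.TTheory GRing.Theory Num.Theory.
Import numFieldNormedType.Exports.

Local Open Scope classical_set_scope.
Local Open Scope ring_scope.

Definition Q (R : realType) (x : R) : R :=
  (Num.sqrt (2 * pi))^-1 *
  \int[@lebesgue_measure R]_(t in `[x, +oo[) expR (- (t ^+ 2) / 2).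

Definition concave_function (R : realType) (f : R -> R) : Prop :=
  convex_function (setT : set R^o) (fun x : R^o => - f x : R^o).

(* [ln] is 0 on nonpositive reals, so positivity is required explicitly for
   [ln \o f] to be the logarithm of [f]. *)
Definition log_concave (R : realType) (f : R -> R) : Prop :=
  (forall x, 0 < f x) /\ concave_function (fun x => ln (f x)).

(* Main.v *)
(* Writing phi for the standard normal density, Q' = - phi and phi' x = - x * phi x,
   so (ln Q)'' <= 0 amounts to x * phi x * Q x <= phi x ^+ 2, that is to Mills'
   inequality x * Q x <= phi x. The latter is trivial for x <= 0, and for 0 < x
   it compares the integrals of x * phi t and t * phi t over [x, +oo[. By the
   Gaussian integral and symmetry 1 - Q x = Q (- x), so the same inequality at
   - x gives the log-concavity of 1 - Q. *)
Require Import Defs.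
From mathcomp Require Import all_boot all_order all_algebra.
From mathcomp Require Import all_classical all_reals all_analysis.
From mathcomp Require Import measurable_realfun.
From mathcomp Require Import ring lra.

Local Open Scope ring_scope.

Import Order.TTheory GRing.Theory Num.Theory.
Import numFieldNormedType.Exports.

Local Open Scope classical_set_scope.
Local Open Scope convex_scope.

(** The second derivative of [- ln f] is [- (f'' * f - f' ^+ 2) / f ^+ 2], which the last hypothesis
    makes nonnegative. *)
Lemma log_concave_derive2 (R : realType) (f f' f'' : R -> R) :
  (forall x, 0 < f x) ->
  (forall x : R, is_derive x 1 f (f' x)) ->
  (forall x : R, is_derive x 1 f' (f'' x)) ->
  (forall x, f'' x * f x <= f' x ^+ 2) ->
  log_concave f.
Proof.
move=> f_gt0 df df' ff; split=> // t x y _ _.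
pose g : R -> R := fun z => - ln (f z).
have dg (z : R) : is_derive z 1 g (- (f' z / f z)).
  apply: is_deriveN; rewrite mulrC.
  exact: is_derive1_comp (is_derive1_ln (f_gt0 z)) (df z).
have DgE : 'D_1 g = fun z => - (f' z / f z).
  by apply/funext => z; rewrite derive_val.
pose h z := - ((f'' z * f z - f' z ^+ 2) / f z ^+ 2).
have ddg (z : R) : is_derive z 1 ('D_1 g) (h z).
  have fz0 : f z != 0 by rewrite gt_eqF.
  rewrite DgE; apply: is_deriveN.
  have /= H := is_deriveM (df' z) (is_deriveV fz0 (df z)).
  by apply: is_derive_eq; rewrite /GRing.scale/=; field.
have cg : continuous g.
  by move=> z; apply/differentiable_continuous/derivable1_diffP/ex_derive.
have h_ge0 z : 0 <= 'D_1 ('D_1 g) z.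
  by rewrite derive_val /h -mulNr opprB divr_ge0 ?sqr_ge0 ?subr_ge0.
(* The second-derivative test wants ordered endpoints; the other order follows by swapping the two
   points and their weights with [convC]. *)
have main (a b : R) (s : {i01 R}) : a <= b ->
    g ((a : R^o) <| s |> (b : R^o)) <= (g a : R^o) <| s |> (g b : R^o).
  apply: second_derivative_convex => //.
  - exact/cvg_at_left_filter/cg.
  - exact/cvg_at_right_filter/cg.
have [xy|/ltW yx] := leP (x : R) (y : R); first exact: main.
by rewrite convC [leRHS]convC; exact: main.
Qed.

Section gaussian_tail.
Context {R : realType}.
Notation mu := (@lebesgue_measure R).
Local Notation phi := (@normal_pdf R 0 1).

Let phiE x : phi x = (Num.sqrt (2 * pi))^-1 * expR (- (x ^+ 2) / 2).
Proof.
rewrite normal_pdfE ?oner_neq0// /normal_peak /normal_fun.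
by rewrite subr0 expr1n mul1r mulr_natl.
Qed.

Let phi_gt0 x : 0 < phi x.
Proof. by rewrite phiE mulr_gt0 ?expR_gt0// invr_gt0 sqrtr_gt0 mulr_gt0 ?pi_gt0. Qed.

Lemma normal_pdf01N x : phi (- x) = phi x.
Proof. by rewrite !phiE sqrrN. Qed.

Let continuous_phi : continuous phi.
Proof. exact/continuous_normal_pdf/oner_neq0. Qed.

Lemma is_derive_normal_pdf01 (x : R) : is_derive x 1 phi (- x * phi x).
Proof.
rewrite (_ : phi = fun y => (Num.sqrt (2 * pi))^-1 * expR (- (y ^+ 2) / 2)); last first.
  by apply/funext => y; exact: phiE.
apply: is_derive_eq; rewrite /GRing.scale/=; field.
by rewrite gt_eqF// sqrtr_gt0 mulr_gt0 ?pi_gt0.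
Qed.

Let integrable_phi (A : set R) : measurable A -> mu.-integrable A (EFin \o phi).
Proof.
by move=> mA; apply: integrableS (integrable_normal_pdf 0 1) => //; exact: subsetT.
Qed.

Lemma Q_normal_pdf (x : R) : Q x = \int[mu]_(t in `[x, +oo[) phi t.
Proof.
rewrite /Q; under [RHS]eq_Rintegral do rewrite phiE.
rewrite RintegralZl//.
(* Pulling the constant out requires integrability of the bare exponential, which is [c] times the
   integrable density. *)
pose c : R := Num.sqrt (2 * pi).
have c0 : c != 0 by rewrite gt_eqF// sqrtr_gt0 mulr_gt0 ?pi_gt0.
have -> : EFin \o (fun t => expR (- t ^+ 2 / 2)) = fun t => (c%:E * (EFin \o phi) t)%E.
  by apply/funext => t; rewrite /= -EFinM phiE mulVKf.
by apply: integrableZl => //; exact: integrable_phi.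
Qed.

(** The density has total mass 1, and the endpoint [x] has measure zero. *)
Let onem_Q x : 1 - Q x = \int[mu]_(t in `]-oo, x]) phi t.
Proof.
have := @Rintegral_itvB R phi -oo%O +oo%O x.
rewrite set_itvNyy => /(_ (integrable_phi _ measurableT) isT isT).
rewrite Rintegral_itv_obnd_cbnd ?integrable_phi// -Q_normal_pdf => <-.
by rewrite [X in 1 - (X - _)]/Rintegral integral_normal_pdf/= opprB addrCA subrr addr0.
Qed.

(** Substitute [- t] for [t] in the lower tail and use that [phi] is even. *)
Lemma onem_QE (x : R) : 1 - Q x = Q (- x).
Proof.
rewrite onem_Q Q_normal_pdf /Rintegral -[x in `]-oo, x]]opprK.
rewrite ge0_integration_by_substitutionNy.
- by congr fine; apply: eq_integral => t _ /=; rewrite normal_pdf01N.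
- exact/continuous_subspaceT/continuous_phi.
- by move=> t _; exact/ltW.
Qed.

(** The fundamental theorem is applied to a variable upper bound, hence to [1 - Q] first; [Q] then
    follows. The point [x + 1] is just some bound beyond [x]. *)
Lemma is_derive_onem_Q (x : R) : is_derive x 1 (fun y => 1 - Q y) (phi x).
Proof.
have xx1 : x < x + 1 by rewrite ltrDl.
have [|d dE] := continuous_FTC1 xx1 (integrable_phi _ (measurable_itv (Interval -oo%O (BRight (x + 1)))))
  _ (@continuous_phi x).
  exact: ltNyr.
rewrite (_ : (fun y => 1 - Q y) = fun y => \int[mu]_(t in `]-oo, y]) phi t); last first.
  by apply/funext => y; exact: onem_Q.
by apply: DeriveDef => //; rewrite -derive1E.
Qed.

Lemma is_derive_Q (x : R) : is_derive x 1 (@Q R) (- phi x).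
Proof.
have -> : @Q R = fun y => 1 - (1 - Q y) by apply/funext => y; rewrite subKr.
have H := is_derive_onem_Q x.
by apply: is_derive_eq; rewrite add0r mul1r.
Qed.

(** By the mean value theorem [Q (x + 1) - Q x = - phi c < 0] for some [c], while [Q (x + 1)] is
    nonnegative. *)
Lemma Q_gt0 (x : R) : 0 < Q x.
Proof.
have Q_ge0 : 0 <= Q (x + 1).
  by rewrite Q_normal_pdf; apply: Rintegral_ge0 => t _; exact/ltW.
have x1 : x < x + 1 by rewrite ltrDl.
have cQ : continuous (@Q R).
  move=> z; apply/differentiable_continuous/derivable1_diffP.
  by have ? := is_derive_Q z; exact: ex_derive.
have [|c _] := MVT x1 (fun z _ => is_derive_Q z).
  exact: continuous_subspaceT.
rewrite addrAC subrr add0r mulr1 => QE.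
by have := phi_gt0 c; lra.
Qed.

Lemma cvg_normal_pdf01 : phi x @[x --> +oo] --> (0 : R).
Proof.
under eq_fun do rewrite phiE mulNr.
rewrite -(mulr0 (Num.sqrt (2 * pi))^-1); apply: cvgM; first exact: cvg_cst.
apply: (cvg_comp (fun t => t ^+ 2 / 2) (fun t => expR (- t))); last exact: cvgr_expR.
by apply: gt0_cvgMly; [rewrite invr_gt0|exact: cvgr_expr2].
Qed.

Lemma mulr_Q_le (x : R) : x * Q x <= phi x.
Proof.
have [x0|x_gt0] := leP x 0.
  apply: (@le_trans _ _ 0); last exact/ltW.
  by rewrite mulr_le0_ge0// ltW// Q_gt0.
(* An antiderivative of [t * phi t] is [- phi t], which tends to 0 at infinity, so only the boundary
   term at [x] remains. *)
have intE : (\int[mu]_(t in `[x, +oo[) (t * phi t)%:E = (phi x)%:E)%E.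
  rewrite (@ge0_continuous_FTC2y _ _ (fun t => - phi t) _ 0).
  - by rewrite sub0e EFinN oppeK.
  - by move=> t xt; rewrite mulr_ge0 ?(ltW (phi_gt0 _))// (le_trans (ltW x_gt0)).
  - apply: continuous_subspaceT => t.
    by apply: cvgM; [exact: cvg_id|exact: continuous_phi].
  - by rewrite -[X in _ --> X]oppr0; apply: cvgN; exact: cvg_normal_pdf01.
  - by move=> t _; apply: derivableN; have ? := is_derive_normal_pdf01 t; exact: ex_derive.
  - by apply: cvgN; exact/cvg_at_right_filter/continuous_phi.
  - move=> t _; have ? := is_derive_normal_pdf01 t.
    by rewrite derive1E derive_val mulNr opprK.
rewrite -lee_fin EFinM -intE Q_normal_pdf.
rewrite fineK ?integrable_fin_num//; last exact: integrable_phi.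
have mphi : measurable_fun `[x, +oo[ phi.
  by apply: measurable_funTS; exact: measurable_normal_pdf.
rewrite -ge0_integralZl//=.
- apply: ge0_le_integral => //.
  + by move=> t _; rewrite mule_ge0// lee_fin ltW.
  + by apply: measurable_funeM; exact/measurable_EFinP.
  + by apply/measurable_EFinP; exact: measurable_funM.
  + by move=> t; rewrite /= in_itv/= andbT => xt; rewrite -EFinM lee_fin ler_pM2r.
- exact/measurable_EFinP.
- by move=> t _; rewrite lee_fin ltW.
- by rewrite lee_fin ltW.
Qed.

End gaussian_tail.

Theorem lemma1 (R : realType) :
  log_concave (@Q R) /\ log_concave (fun x : R => 1 - Q x).
Proof.
have phi_ge0 x : 0 <= @normal_pdf R 0 1 x by exact: normal_pdf_ge0.
split.
- apply: (@log_concave_derive2 _ _ (fun x => - normal_pdf 0 1 x)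
    (fun x => x * normal_pdf 0 1 x)) => x.
  + exact: Q_gt0.
  + exact: is_derive_Q.
  + have ? := is_derive_normal_pdf01 x.
    by apply: is_derive_eq; rewrite mulNr opprK.
  (* Cancelling one nonnegative factor [phi x] leaves Mills' inequality. *)
  + rewrite sqrrN expr2 mulrAC ler_wpM2r//.
    exact: mulr_Q_le.
- apply: (@log_concave_derive2 _ _ (normal_pdf 0 1)
    (fun x => - x * normal_pdf 0 1 x)) => x.
  + by rewrite onem_QE Q_gt0.
  + exact: is_derive_onem_Q.
  + exact: is_derive_normal_pdf01.
  + rewrite onem_QE expr2 mulrAC ler_wpM2r//.
    by rewrite (le_trans (mulr_Q_le _))// normal_pdf01N.
Qed.
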